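(* Let $A\in\mathbb{R}^{M\times N}$ with $M<N$ have nonzero columns, let $d\in\mathbb{R}^M$ and $\beta>0$, and let $F_d(u)=\|Au-d\|_2^2+\beta\|u\|_0$ have a (local) minimum at $\hat u\in\mathbb{R}^N$. Then, for $\hat\sigma=\sigma(\hat u)$, $\hat u$ solves problem $(\mathcal P_{\hat\sigma})$: minimize $\|Au-d\|_2^2$ over $u\in\mathbb{R}^N$ subject to $u[i]=0$ for all $i\in\{1,\dots,N\}\setminus\hat\sigma$.
   Context: For $u\in\mathbb{R}^N$, $\sigma(u)=\{i\in\{1,\dots,N\}: u[i]\ne0\}$ is the support and $\|u\|_0=\#\sigma(u)$ its cardinality. $F_d$ has a (local) minimum at $\hat u$ if there is an open neighborhood $O$ of $\hat u$ with $F_d(\hat u)=\min_{u\in O}F_d(u)$. *)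

(* Defs.v *)
From HB Require Import structures.
From mathcomp Require Import all_boot all_order all_algebra.
From mathcomp Require Import all_classical all_reals all_analysis.
Import Order.TTheory GRing.Theory Num.Theory.
Import numFieldNormedType.Exports.
Set Implicit Arguments.
Unset Strict Implicit.
Unset Printing Implicit Defensive.

Local Open Scope classical_set_scope.
Local Open Scope ring_scope.

(* The norm carried by 'cV[R]_N in MathComp-Analysis is the max norm, hence
   this separate Euclidean norm; the two induce the same topology. *)
Definition norm2 (R : realType) (n : nat) (v : 'cV[R]_n) : R :=
  Num.sqrt (\sum_(i < n) v i 0 ^+ 2).

Definition supp (R : realType) (N : nat) (u : 'cV[R]_N) : {set 'I_N} :=
  [set i : 'I_N | u i 0 != 0]%SET.

Definition norm0 (R : realType) (N : nat) (u : 'cV[R]_N) : nat := #|supp u|.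

Definition residual (R : realType) (M N : nat) (A : 'M[R]_(M, N))
    (d : 'cV[R]_M) (u : 'cV[R]_N) : R :=
  norm2 (A *m u - d) ^+ 2.

Definition Fd (R : realType) (M N : nat) (A : 'M[R]_(M, N))
    (d : 'cV[R]_M) (beta : R) (u : 'cV[R]_N) : R :=
  residual A d u + beta * (norm0 u)%:R.

Definition has_local_min (T : topologicalType) (R : realType)
    (f : T -> R) (x : T) : Prop :=
  exists O : set T, [/\ open O, O x & forall y, O y -> f x <= f y].

Definition is_minimizer_on (T : Type) (R : realType)
    (f : T -> R) (K : set T) (x : T) : Prop :=
  K x /\ forall y, K y -> f x <= f y.

Definition supported_in (R : realType) (N : nat) (omega : {set 'I_N}) :
    set 'cV[R]_N :=
  [set u : 'cV[R]_N | forall i : 'I_N, i \in (~: omega)%SET -> u i 0 = 0].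

Definition solves_P (R : realType) (M N : nat) (A : 'M[R]_(M, N))
    (d : 'cV[R]_M) (omega : {set 'I_N}) (u : 'cV[R]_N) : Prop :=
  is_minimizer_on (residual A d) (supported_in omega) u.

(* Main.v *)
(** Along the segment from [uhat] to a feasible [v] the support stays inside
    that of [uhat], so local minimality of [Fd] passes to the convex residual,
    and a local minimum of a convex function along a segment is a minimum. *)
Require Import Defs.
From HB Require Import structures.
From mathcomp Require Import all_boot all_order all_algebra.
From mathcomp Require Import all_classical all_reals all_analysis.
From mathcomp Require Import ring lra.
Import Order.TTheory GRing.Theory Num.Theory.
Import numFieldNormedType.Exports.
Local Open Scope classical_set_scope.
Local Open Scope ring_scope.

Lemma norm2_sqr (R : realType) (n : nat) (v : 'cV[R]_n) :
  norm2 v ^+ 2 = \sum_(i < n) v i 0 ^+ 2.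
Proof. by rewrite sqr_sqrtr// sumr_ge0// => i _; exact: sqr_ge0. Qed.

(** Coordinate by coordinate, the gap between the two sides is a square times [t * (1 - t)], which
    is nonnegative on the unit interval. *)
Lemma norm2_sqr_convex (R : realType) (n : nat) (x y : 'cV[R]_n) (t : R) :
  0 <= t <= 1 ->
  norm2 (x + t *: (y - x)) ^+ 2 <= (1 - t) * norm2 x ^+ 2 + t * norm2 y ^+ 2.
Proof.
move=> /andP[t0 t1]; rewrite !norm2_sqr !mulr_sumr -big_split/=.
apply: ler_sum => i _; rewrite !mxE -subr_ge0.
have -> : (1 - t) * x i 0 ^+ 2 + t * y i 0 ^+ 2 - (x i 0 + t * (y i 0 - x i 0)) ^+ 2
  = t * (1 - t) * (y i 0 - x i 0) ^+ 2 by ring.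
by rewrite mulr_ge0 ?sqr_ge0// mulr_ge0 ?subr_ge0.
Qed.

(** The affine map [A *m u - d] carries segments to segments with the same parameter, so convexity
    of the squared norm pulls back along it. *)
Lemma residual_convex (R : realType) (M N : nat) (A : 'M[R]_(M, N))
    (d : 'cV[R]_M) (u v : 'cV[R]_N) (t : R) : 0 <= t <= 1 ->
  residual A d (u + t *: (v - u)) <= (1 - t) * residual A d u + t * residual A d v.
Proof.
move=> t01; rewrite /residual.
have -> : A *m (u + t *: (v - u)) - d =
    (A *m u - d) + t *: ((A *m v - d) - (A *m u - d)).
  by rewrite mulmxDr -scalemxAr mulmxBr opprB addrA subrK addrAC.
exact: norm2_sqr_convex.
Qed.

Lemma norm0_le_supported_in (R : realType) (N : nat) (u : 'cV[R]_N)
    (omega : {set 'I_N}) : supported_in omega u -> (norm0 u <= #|omega|)%N.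
Proof.
move=> uo; apply/subset_leq_card/fintype.subsetP => i.
by rewrite inE; apply: contraNT => io; apply/eqP/uo; rewrite inE.
Qed.

Lemma open_segment (R : realType) (N : nat) (O : set 'cV[R]_N)
    (x y : 'cV[R]_N) : open O -> O x ->
  exists t : R, 0 < t <= 1 /\ O (x + t *: y).
Proof.
move=> oO Ox.
have cvg_segment : x + t *: y @[t --> (0 : R)^'+] --> x.
  (* Writing the limit as the value at [t = 0] lets the sum and scaling rules for limits apply. *)
  have -> : nbhs x = nbhs (x + 0 *: y) by rewrite scale0r addr0.
  apply: cvgD; first exact: cvg_cst.
  apply: cvgZr_tmp.
  exact: cvg_at_right_filter.
have near_O : \forall t \near (0 : R)^'+, O (x + t *: y).
  by apply: cvg_segment; exact: open_nbhs_nbhs.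
(* The right-hand filter at 0 is proper, so an actual [t] exists, and it is strictly positive. *)
have /filter_ex[t [t0 t1 Ot]] : \forall t \near (0 : R)^'+,
    [/\ 0 < t, t <= 1 & O (x + t *: y)].
  by near=> t; split; near: t => //; [exact: nbhs_right_gt|exact: nbhs_right_le].
by exists t; rewrite t0 t1.
Unshelve. all: by end_near. Qed.

Theorem lemma2p4 (R : realType) (M N : nat) (hMN : (M < N)%N)
    (A : 'M[R]_(M, N)) (hA : forall j : 'I_N, col j A != 0)
    (d : 'cV[R]_M) (beta : R) (hbeta : 0 < beta)
    (uhat : 'cV[R]_N) (hmin : has_local_min (Fd A d beta) uhat) :
  solves_P A d (supp uhat) uhat.
Proof.
have uhat_feasible : supported_in (supp uhat) uhat.
  by move=> i; rewrite !inE negbK => /eqP.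
split=> // v v_feasible.
case: hmin => U [oU Uuhat minU].
have [t [/andP[t0 t1] Ut]] := open_segment _ _ _ _ (v - uhat) oU Uuhat.
have seg_feasible : supported_in (supp uhat) (uhat + t *: (v - uhat)).
  by move=> i hi; rewrite !mxE uhat_feasible// v_feasible// subrr mulr0 addr0.
(* The penalty cannot grow along the segment, so the inequality for [Fd] descends to the
   residual. *)
have norm0_seg : beta * (norm0 (uhat + t *: (v - uhat)))%:R <=
    beta * (norm0 uhat)%:R.
  by rewrite ler_pM2l// ler_nat norm0_le_supported_in.
have min_seg := minU _ Ut; rewrite /Fd in min_seg.
have t01 : 0 <= t <= 1 by rewrite (ltW t0).
have convex_seg := residual_convex _ _ _ A d uhat v _ t01.
(* With r the residual, r(uhat) is at most r at the segment point, hence at most [(1 - t)] r(uhat) +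
   [t] r(v). This bounds [t] (r(v) - r(uhat)) below by 0, and [t > 0] can be divided out. *)
rewrite -subr_ge0 -(pmulr_rge0 _ t0); lra.
Qed.
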